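(* Let $K$ be a commutative ring with unit containing $\mathbb{Q}$, let $n$ be an odd positive integer, and for each odd $k$ with $3\le k\le n$ let $y^{[k]}=(y^{[k]}_{\alpha_1\ldots\alpha_k})_{(\alpha_1,\ldots,\alpha_k)\in[n]^k}$ be a completely antisymmetric tensor with entries in $K$. Then the Berezin integral \[ \int\mathrm d\chi_n\cdots\mathrm d\chi_1\ \chi_i\exp\Big(\sum_{\substack{3\le k\le n\\ k\ \mathrm{odd}}}\frac{1}{(k-1)!}\sum_{(\alpha_1,\ldots,\alpha_k)\in[n]^k}y^{[k]}_{\alpha_1\ldots\alpha_k}\chi_{\alpha_2}\chi_{\alpha_3}\cdots\chi_{\alpha_k}\Big) \] is independent of $i\in[n]$ and is equal to $\sum_{\mathcal A}\mathcal Y_{\mathcal A}$, where the sum runs over all odd cacti $\mathcal A$ on $[n]$.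
   Context: The Grassmann algebra $K[\chi_1,\ldots,\chi_n]$ is the quotient of the free noncommutative $K$-algebra on $\chi_1,\ldots,\chi_n$ by the two-sided ideal generated by $\chi_i\chi_j+\chi_j\chi_i$; the argument of the exponential is even and nilpotent, and $\exp(f)=\sum_{p\ge0}f^p/p!$. For $f\in K[\chi]$, $\int\mathrm d\chi_n\cdots\mathrm d\chi_1\,f$ denotes the coefficient of $\chi_1\chi_2\cdots\chi_n$ in $f$. Complete antisymmetry: $y^{[k]}_{\alpha_{\sigma(1)}\ldots\alpha_{\sigma(k)}}=\mathrm{sgn}(\sigma)y^{[k]}_{\alpha_1\ldots\alpha_k}$. Let $\tilde{\mathcal O}_n$ be the set of subsets of $[n]$ of odd cardinality $\ge3$. For $\mathcal A\subseteq\tilde{\mathcal O}_n$, $G(\mathcal A)$ is the bipartite graph on $\mathcal A\sqcup[n]$ with edges $(A,j)$, $j\in A$; $\mathcal A$ is an odd cactus if $G(\mathcal A)$ is a tree (connected and acyclic; e.g. for $n=1$ the empty set is an odd cactus). Let $\mathcal O_n$ be the set of sequences $\alpha=(\alpha_1,\ldots,\alpha_k)$ of distinct elements of $[n]$, $k$ odd, $3\le k\le n$, and $\tilde\alpha=\{\alpha_1,\ldots,\alpha_k\}$. $\mathcal C\subseteq\mathcal O_n$ is a refined cactus if distinct elements have distinct underlying sets and $\mathcal A(\mathcal C)=\{\tilde\alpha:\alpha\in\mathcal C\}$ is an odd cactus. For a root $i\in[n]$ and $\alpha\in\mathcal C$, the local root of $\alpha$ is the first vertex of $[n]$ on the shortest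 path in $G(\mathcal A(\mathcal C))$ from $\tilde\alpha$ to $i$, say $\alpha_s$; the circulation is $\hat\alpha=(\alpha_{s+1},\ldots,\alpha_k,\alpha_1,\ldots,\alpha_{s-1})$. Ordering $\mathcal C$ arbitrarily, let $\pi$ be the concatenation of $(i)$ with all $\hat\alpha$, $\alpha\in\mathcal C$; it is a permutation of $(1,\ldots,n)$, and $\epsilon_{i,\mathcal C}$ is its signature (independent of the ordering). Set $\mathcal Y_{i,\mathcal C}=\epsilon_{i,\mathcal C}\prod_{\alpha\in\mathcal C}y^{[k]}_{\alpha_1\ldots\alpha_k}$. For an odd cactus $\mathcal A$, $\mathcal Y_{\mathcal A}$ denotes the common value of $\mathcal Y_{i,\mathcal C}$ over all $i\in[n]$ and refined cacti $\mathcal C$ with $\mathcal A(\mathcal C)=\mathcal A$ (this value does not depend on these choices). *)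

(* Defs.v *)
From HB Require Import structures.
From mathcomp Require Import all_boot all_order fingroup perm all_algebra.
From mathcomp Require Import boolp.
From mathcomp Require classical_sets.

Set Implicit Arguments.
Unset Strict Implicit.
Unset Printing Implicit Defensive.

Import GRing.Theory.
Local Open Scope ring_scope.

(* The Grassmann algebra K[chi_1, ..., chi_n] is realised on its basis of     *)
(* ordered monomials: f : grassmann K n stands for                            *)
(*   \sum_(I : {set 'I_n}) f I *: chi_I,                                      *)
(* chi_I being the product of the chi_i for i in I in increasing order (see   *)
(* grassmann_expand).  When K contains rat this is the free K-algebra on the  *)
(* chi_i modulo chi_i chi_j + chi_j chi_i: see grassmann_universal.  The      *)
(* alias hides the pointwise product that {ffun _ -> K} carries.              *)
Definition grassmann (K : comNzRingType) (n : nat) := {ffun {set 'I_n} -> K}.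

HB.instance Definition _ (K : comNzRingType) (n : nat) :=
  GRing.Zmodule.copy (grassmann K n) {ffun {set 'I_n} -> K}.

Definition inversions (n : nat) (I J : {set 'I_n}) : nat :=
  (\sum_(i in I) \sum_(j in J) (j < i))%N.

Section GrassmannRing.
Variables (K : comNzRingType) (n : nat).
Implicit Types (f g h : grassmann K n) (I J L S : {set 'I_n}) (i j : 'I_n).

(* chi_I * chi_J is (-1) ^ (inversions I J) chi_(I :|: J) if I and J are      *)
(* disjoint, and 0 otherwise.                                                 *)
Definition gmul f g : grassmann K n :=
  [ffun S : {set 'I_n} => \sum_(I : {set 'I_n} | I \subset S)
     (-1) ^+ inversions I (S :\: I) * (f I * g (S :\: I))].
Definition gone : grassmann K n := [ffun S : {set 'I_n} => (S == set0)%:R].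
Definition gscale (a : K) f : grassmann K n := [ffun S : {set 'I_n} => a * f S].

Lemma inversionsUl I J L : [disjoint I & J] ->
  inversions (I :|: J) L = (inversions I L + inversions J L)%N.
Proof. by move=> dIJ; rewrite /inversions -bigU //=; apply: eq_bigl => i; rewrite !inE. Qed.

Lemma inversionsUr I J L : [disjoint J & L] ->
  inversions I (J :|: L) = (inversions I J + inversions I L)%N.
Proof.
move=> dJL; rewrite /inversions -big_split; apply: eq_bigr => i _ /=.
by rewrite -bigU //=; apply: eq_bigl => j; rewrite !inE.
Qed.

Lemma inversions0l I : inversions set0 I = 0%N.
Proof. by rewrite /inversions big_set0. Qed.

Lemma inversions0r I : inversions I set0 = 0%N.
Proof. by rewrite /inversions big1 // => i _; rewrite big_set0. Qed.

Lemma gmulA : associative gmul.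
Proof.
move=> f g h; apply/ffunP=> S; rewrite !ffunE.
transitivity (\sum_(I : {set 'I_n} | I \subset S) \sum_(U : {set 'I_n} | (U \subset S) && (I \subset U))
   (-1) ^+ inversions U (S :\: U) * ((-1) ^+ inversions I (U :\: I) * (f I * g (U :\: I)) * h (S :\: U))).
  apply: eq_bigr => I sIS; rewrite ffunE !mulr_sumr.
  rewrite [RHS](reindex_onto (fun J : {set 'I_n} => I :|: J) (fun U => U :\: I)) /=; last first.
    by move=> U /andP[_ /subsetP sIU]; apply/setP=> x; rewrite !inE; have := sIU x; case: (x \in I) => //= ->.
  apply: eq_big => [J|J].
    rewrite subUset sIS subsetUl subsetD /= andbT.
    congr (_ && _); rewrite setDUl setDv set0U.
    by apply/idP/eqP => [/disjoint_setI0|<-]; [move=> d; rewrite setDE; apply/setIidPl; rewrite -disjoints_subset -setI_eq0 d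
      | rewrite disjoint_sym disjoints_subset setDE setCI setCK subsetUr].
  rewrite subsetD => /andP[sJS dJI].
  have -> : (I :|: J) :\: I = J.
    apply/setP=> x; rewrite !inE; have := @disjointFr _ _ _ x dJI.
    by case: (x \in J); case: (x \in I) => // /(_ isT).
  rewrite setDDl.
  have E : S :\: I = J :|: (S :\: (I :|: J)).
    apply/setP=> x; rewrite !inE; have := subsetP sJS x; have := @disjointFr _ _ _ x dJI.
    by case: (x \in J) => [/(_ isT) -> /(_ isT) ->|_ _]; rewrite ?orbF.
  have d1 : [disjoint J & S :\: (I :|: J)].
    by rewrite -setI_eq0; apply/eqP/setP=> x; rewrite !inE; case: (x \in J); rewrite ?orbT ?andbF.
  rewrite [in inversions I (S :\: I)]E inversionsUr // inversionsUl 1?disjoint_sym // !exprD.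
  rewrite !mulrA; congr (_ * _ * _); rewrite -!mulrA.
  set a := (-1) ^+ _; set b := (-1) ^+ _; set c := (-1) ^+ _.
  by rewrite mulrCA; congr (_ * _); rewrite [c * _]mulrCA [f I * c]mulrC.
rewrite (exchange_big_dep (fun U : {set 'I_n} => U \subset S)) /=; last by move=> I U _ /andP[].
apply: eq_bigr => U sUS; rewrite ffunE mulr_suml mulr_sumr.
apply: eq_big => [I|//]; rewrite sUS /=.
by case sIU: (I \subset U); rewrite ?andbF // (subset_trans sIU).
Qed.

Lemma gmul1l : left_id gone gmul.
Proof.
move=> f; apply/ffunP=> S; rewrite ffunE (bigD1 set0) ?sub0set //= big1.
  by rewrite ffunE eqxx inversions0l setD0 addr0 !mul1r.
by move=> I /andP[_ /negPf I0]; rewrite ffunE I0 mul0r mulr0.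
Qed.

Lemma gmul1r : right_id gone gmul.
Proof.
move=> f; apply/ffunP=> S; rewrite ffunE (bigD1 S) //= big1.
  by rewrite ffunE setDv eqxx inversions0r addr0 mulr1 mul1r.
move=> I /andP[sIS nIS]; rewrite ffunE setD_eq0.
suff /negPf-> : ~~ (S \subset I) by rewrite !mulr0.
by apply: contra nIS => sSI; rewrite eqEsubset sIS.
Qed.

Lemma gmulDl : left_distributive gmul +%R.
Proof.
move=> f g h; apply/ffunP=> S; rewrite !ffunE -big_split /=.
by apply: eq_bigr => I _; rewrite !ffunE mulrDl mulrDr.
Qed.

Lemma gmulDr : right_distributive gmul +%R.
Proof.
move=> f g h; apply/ffunP=> S; rewrite !ffunE -big_split /=.
by apply: eq_bigr => I _; rewrite !ffunE !mulrDr.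
Qed.

Lemma gone_neq0 : gone != 0.
Proof. by apply/eqP => /ffunP /(_ set0) /eqP; rewrite !ffunE eqxx oner_eq0. Qed.

Lemma gscaleA a b f : gscale a (gscale b f) = gscale (a * b) f.
Proof. by apply/ffunP=> S; rewrite !ffunE mulrA. Qed.

Lemma gscale1 : left_id 1 gscale.
Proof. by move=> f; apply/ffunP=> S; rewrite ffunE mul1r. Qed.

Lemma gscaleDr : right_distributive gscale +%R.
Proof. by move=> a f g; apply/ffunP=> S; rewrite !ffunE mulrDr. Qed.

Lemma gscaleDl f : {morph gscale^~ f : a b / a + b}.
Proof. by move=> a b; apply/ffunP=> S; rewrite !ffunE mulrDl. Qed.

Lemma gscaleAl a f g : gscale a (gmul f g) = gmul (gscale a f) g.
Proof.
apply/ffunP=> S; rewrite !ffunE mulr_sumr; apply: eq_bigr => I _.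
by rewrite ffunE mulrCA !mulrA.
Qed.

Lemma gscaleAr a f g : gscale a (gmul f g) = gmul f (gscale a g).
Proof.
apply/ffunP=> S; rewrite !ffunE mulr_sumr; apply: eq_bigr => I _.
by rewrite ffunE mulrCA [a * (_ * _)]mulrCA.
Qed.

HB.instance Definition _ := GRing.Zmodule_isNzRing.Build (grassmann K n)
  gmulA gmul1l gmul1r gmulDl gmulDr gone_neq0.
HB.instance Definition _ := GRing.Zmodule_isLmodule.Build K (grassmann K n)
  gscaleA gscale1 gscaleDr gscaleDl.
HB.instance Definition _ := GRing.Lmodule_isLalgebra.Build K (grassmann K n)
  gscaleAl.
HB.instance Definition _ := GRing.Lalgebra_isAlgebra.Build K (grassmann K n)
  gscaleAr.

Definition chi i : grassmann K n := [ffun S : {set 'I_n} => (S == [set i])%:R].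

(* \int d chi_n ... d chi_1 f: by grassmann_expand this is the coefficient of  *)
(* chi_1 chi_2 ... chi_n in f.                                                *)
Definition berezin f : K := f setT.

Definition gmono S : grassmann K n := [ffun T : {set 'I_n} => (T == S)%:R].

Lemma gmonoE f : f = \sum_(S : {set 'I_n}) f S *: gmono S.
Proof.
apply/ffunP=> T; rewrite sum_ffunE (bigD1 T) //= big1 => [|S nST].
  by rewrite !ffunE eqxx mulr1 addr0.
by rewrite !ffunE eq_sym (negPf nST) mulr0.
Qed.

Lemma mul_chi_gmono i J : chi i * gmono J =
  if i \in J then 0 else (-1) ^+ inversions [set i] J *: gmono (i |: J).
Proof.
apply/ffunP=> S; rewrite ffunE; case: (boolP (i \in S)) => iS; last first.
  rewrite big1 => [|I sIS]; last first.
    rewrite ffunE; case: eqP => [eI|]; last by rewrite mul0r mulr0.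
    by rewrite eI sub1set (negPf iS) in sIS.
  case: ifP => iJ; rewrite !ffunE //.
  case: eqP => [eS|]; last by rewrite mulr0.
  by rewrite eS setU11 in iS.
rewrite (bigD1 [set i]) ?sub1set //= big1 ?addr0 => [|I /andP[_ /negPf nI]]; last first.
  by rewrite ffunE nI mul0r mulr0.
rewrite !ffunE eqxx mul1r; case: ifP => iJ; rewrite !ffunE.
  case: eqP => [eS|]; last by rewrite mulr0.
  by move: iJ; rewrite -eS !inE eqxx.
case: (S =P i |: J) => [->|nS].
  by rewrite setU1K ?iJ // eqxx mulr1.
case: eqP => [eS|]; last by rewrite !mulr0.
by case: nS; rewrite -eS setD1K.
Qed.

Lemma chi_anticomm i j : chi i * chi j + chi j * chi i = 0.
Proof.
have E k l : chi k * chi l =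
    if k == l then 0 else (-1) ^+ (l < k)%N *: gmono (k |: [set l]).
  by rewrite (mul_chi_gmono k [set l]) inE /inversions !big_set1.
rewrite !E eq_sym; case: eqVneq => [|nij]; first by rewrite addr0.
rewrite [j |: _]setUC -scalerDl.
case: (ltngtP i j) nij => [||/val_inj->]; last by rewrite eqxx.
  by rewrite expr0 expr1 addrN scale0r.
by rewrite expr0 expr1 addNr scale0r.
Qed.

End GrassmannRing.

Arguments chi {K n} i.

Section Monomials.
Variable n : nat.
Implicit Types (s : seq 'I_n) (S : {set 'I_n}) (i j : 'I_n).

Lemma ord_lt_trans : transitive (fun i j : 'I_n => i < j)%N.
Proof. by move=> j i k; apply: ltn_trans. Qed.

Lemma enum_sorted S : sorted (fun i j : 'I_n => i < j)%N (enum S).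
Proof.
rewrite {1}/enum_mem sorted_filter //; first exact: ord_lt_trans.
have := iota_ltn_sorted 0 n; rewrite -val_enum_ord sorted_map enumT; exact.
Qed.

Lemma enum_set_sorted s : sorted (fun i j : 'I_n => i < j)%N s ->
  enum [set x in s] = s.
Proof.
move=> ss; apply: (irr_sorted_eq ord_lt_trans) => //; first by move=> x; exact: ltnn.
  exact: enum_sorted.
by move=> x; rewrite mem_enum inE.
Qed.

Variable (A : pzRingType) (x : 'I_n -> A).
Definition xmono S : A := \prod_(i <- enum S) x i.

Lemma xmono_cons j S : (forall k, k \in S -> (j < k)%N) ->
  xmono (j |: S) = x j * xmono S.
Proof.
move=> jS; rewrite /xmono; suff -> : enum (j |: S) = j :: enum S by rewrite big_cons.
have -> : j |: S = [set k in j :: enum S].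
  by apply/setP=> k; rewrite !inE mem_enum.
apply: enum_set_sorted; rewrite /= path_min_sorted ?enum_sorted //.
by apply/allP=> k; rewrite mem_enum; apply: jS.
Qed.

Lemma xmono_mul (xx : forall i, x i * x i = 0)
    (xC : forall i j, x i * x j = - (x j * x i)) i S :
  x i * xmono S =
  if i \in S then 0 else (-1) ^+ inversions [set i] S * xmono (i |: S).
Proof.
have -> : S = [set k in enum S] by apply/setP=> k; rewrite inE mem_enum.
elim: (enum S) (enum_sorted S) => [_|j s IH pjs].
  rewrite !inE.
  have -> : [set k in [::]] = set0 :> {set 'I_n} by apply/setP=> k; rewrite !inE.
  by rewrite inversions0r mul1r xmono_cons // => k; rewrite inE.
have js k : k \in [set k in s] -> (j < k)%N.
  rewrite inE => ks; have := order_path_min ord_lt_trans pjs.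
  by move/allP/(_ k ks).
have -> : [set k in j :: s] = j |: [set k in s] by apply/setP=> k; rewrite !inE.
set T := [set k in s] in js *.
have {}IH := IH (path_sorted pjs).
rewrite (xmono_cons js) in_setU1; case: eqVneq => [->|nij] /=.
  by rewrite mulrA xx mul0r.
have jT : [disjoint [set j] & T].
  by rewrite disjoints1; apply/negP => /js; rewrite ltnn.
rewrite inversionsUr // {1}/inversions !big_set1.
case: (ltngtP i j) nij => [lij _|lji _|/val_inj->]; last by rewrite eqxx.
  have iT k : k \in j |: T -> (i < k)%N.
    by rewrite in_setU1 => /orP[/eqP->//|/js]; apply: ltn_trans.
  case: ifP => [iT'|_].
    by have := iT i; rewrite in_setU1 iT' orbT ltnn => /(_ isT).
  rewrite (xmono_cons iT) (xmono_cons js) /inversions big_set1 big1 ?mul1r // => k kT.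
  by case: ltnP => // ki; have := iT k; rewrite in_setU1 kT orbT ltnNge ltnW // => /(_ isT).
rewrite mulrA xC mulNr -mulrA IH; case: ifP => [_|_]; first by rewrite mulr0 oppr0.
rewrite exprD expr1 mulN1r mulNr; congr (- _).
have jU k : k \in i |: T -> (j < k)%N.
  by rewrite in_setU1 => /orP[/eqP->//|]; apply: js.
by rewrite mulrA (commr_sign (x j) _) -mulrA setUCA (xmono_cons jU).
Qed.

End Monomials.

Section GrassmannTheory.
Variable n : nat.

Lemma gmono_chi (K : comNzRingType) (S : {set 'I_n}) :
  gmono K S = \prod_(i <- enum S) chi i.
Proof.
rewrite {1}(_ : S = [set k in enum S]); last by apply/setP=> k; rewrite inE mem_enum.
elim: (enum S) (enum_sorted S) => [_|j s IH pjs].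
  by rewrite big_nil; apply/ffunP=> T; rewrite !ffunE; congr (_ == _)%:R; apply/setP=> k; rewrite !inE.
rewrite big_cons -IH ?(path_sorted pjs) // mul_chi_gmono.
have /allP js := order_path_min (@ord_lt_trans n) pjs.
rewrite inE; case: ifP => [/js|_]; first by rewrite ltnn.
rewrite /inversions big_set1 big1 ?scale1r => [|k].
  by congr gmono; apply/setP=> k; rewrite !inE.
by rewrite inE => /js jk; rewrite ltnNge ltnW.
Qed.

Theorem grassmann_expand (K : comNzRingType) (f : grassmann K n) :
  f = \sum_(S : {set 'I_n}) f S *: \prod_(i <- enum S) chi i.
Proof. by rewrite {1}[f]gmonoE; apply: eq_bigr => S _; rewrite gmono_chi. Qed.

Lemma two_inj (K : comAlgType rat) (A : lmodType K) (v : A) : v + v = 0 -> v = 0.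
Proof.
rewrite -mulr2n -scaler_nat => v2.
have half : ((2%:R^-1 : rat)%:A : K) * 2%:R = 1.
  by rewrite mulr_algl -scaler_nat scalerA mulVf ?scale1r.
by rewrite -[v]scale1r -half -scalerA v2 scaler0.
Qed.

Theorem grassmann_universal (K : comAlgType rat) (A : algType K)
    (x : 'I_n -> A) (hx : forall i j, x i * x j + x j * x i = 0) :
  exists phi : {lrmorphism grassmann K n -> A},
    (forall i, phi (chi i) = x i) /\
    (forall psi : {lrmorphism grassmann K n -> A},
       (forall i, psi (chi i) = x i) -> psi =1 phi).
Proof.
have xx i : x i * x i = 0 by exact: two_inj (hx i i).
have xC i j : x i * x j = - (x j * x i) by apply/eqP; rewrite -addr_eq0 hx.
pose phi (f : grassmann K n) : A := \sum_(S : {set 'I_n}) f S *: xmono x S.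
have lphi : linear phi.
  move=> a f g; rewrite /phi scaler_sumr -big_split; apply: eq_bigr => S _ /=.
  by rewrite !ffunE scalerA scalerDl.
pose Lmixin := GRing.isLinear.Build _ _ _ _ phi lphi.
pose L : {linear grassmann K n -> A} := HB.pack phi Lmixin.
have Lmono S : L (gmono K S) = xmono x S.
  rewrite /= /phi (bigD1 S) //= big1 ?addr0 => [|T nT]; first by rewrite ffunE eqxx scale1r.
  by rewrite ffunE (negPf nT) scale0r.
have Lchi i f : L (chi i * f) = x i * L f.
  rewrite [f]gmonoE mulr_sumr !linear_sum mulr_sumr; apply: eq_bigr => S _.
  rewrite -scalerAr !linearZ -scalerAr mul_chi_gmono !Lmono xmono_mul //.
  case: ifP => _; first by rewrite linear0.
  by rewrite linearZ_LR Lmono -signr_odd scaler_sign -(@signr_odd A) mulr_sign.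
have L1 : L 1 = 1.
  by rewrite -[1]/(gmono K set0) Lmono /xmono enum_set0 big_nil.
have LM : {morph L : f g / f * g}.
  move=> f g; rewrite [f]grassmann_expand mulr_suml !linear_sum mulr_suml.
  apply: eq_bigr => S _; rewrite -scalerAl !linearZ -scalerAl; congr (_ *: _).
  elim: (enum S) => [|i s IH]; first by rewrite big_nil L1 !mul1r.
  by rewrite big_cons -mulrA !Lchi IH mulrA.
pose Pmixin := GRing.isMonoidMorphism.Build _ _ phi (conj L1 LM).
pose P : {lrmorphism grassmann K n -> A} := HB.pack phi Lmixin Pmixin.
exists P; split=> [i|psi hpsi f].
  by rewrite -[LHS]/(L (chi i)) -[chi i]mulr1 Lchi L1 mulr1.
rewrite -[RHS]/(L f) [f]grassmann_expand !linear_sum; apply: eq_bigr => S _.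
rewrite !linearZ; congr (_ *: _).
elim: (enum S) => [|i s IH]; first by rewrite big_nil rmorph1 L1.
by rewrite big_cons Lchi -IH -hpsi; apply: rmorphM.
Qed.

Lemma gpow_eq0 (K : comNzRingType) (f : grassmann K n) (p : nat) (S : {set 'I_n}) :
  f set0 = 0 -> (#|S| < p)%N -> (f ^+ p) S = 0.
Proof.
move=> f0; elim: p S => // p IH S ltSp; rewrite exprS ffunE big1 // => I sIS.
have [->|I0] := eqVneq I set0; first by rewrite f0 mul0r mulr0.
rewrite IH ?mulr0 // cardsD (setIidPr sIS).
rewrite -card_gt0 in I0; have := subset_leq_card sIS.
by move: ltSp I0; case: #|I| => // k; rewrite ltnS => h _ k1; rewrite (leq_trans _ h) // ltn_subrL /= (leq_trans _ k1).
Qed.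

End GrassmannTheory.

(* The series stops at p = n because f ^+ p vanishes for p > n as soon as f   *)
(* has no constant term (gexpE).                                              *)
Definition gexp (K : comAlgType rat) (n : nat) (f : grassmann K n) :
    grassmann K n :=
  \sum_(p < n.+1) ((p`!%:R^-1 : rat)%:A : K) *: f ^+ p.

Lemma gexpE (K : comAlgType rat) (n N : nat) (f : grassmann K n) :
  f set0 = 0 -> (n < N)%N ->
  gexp f = \sum_(p < N) ((p`!%:R^-1 : rat)%:A : K) *: f ^+ p.
Proof.
move=> f0 nN; rewrite /gexp (big_ord_widen N (fun p => ((p`!%:R^-1 : rat)%:A : K) *: f ^+ p)) //.
rewrite big_mkcond; apply: eq_bigr => p _ /=; case: ifP => //.
move=> /negbT; rewrite -leqNgt => np; suff -> : f ^+ p = 0 by rewrite scaler0.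
apply/ffunP=> S; rewrite ffunE gpow_eq0 //; apply: leq_ltn_trans np.
by have := max_card (mem S); rewrite card_ord.
Qed.

Definition completely_antisymmetric (K : pzRingType) (n k : nat)
    (y : k.-tuple 'I_n -> K) : Prop :=
  forall (s : 'S_k) (a : k.-tuple 'I_n),
    y [tuple tnth a (s j) | j < k] = (-1) ^+ s * y a.

(* Graphs are given by a vertex set V and a symmetric adjacency relation e    *)
(* between elements of V.                                                     *)
Definition is_tree (T : finType) (V : {set T}) (e : rel T) : Prop :=
  {in V &, forall u v, connect e u v} /\
  (forall p : seq T, (2 < size p)%N -> ~ ucycle e p).

Definition shortest_path (T : eqType) (e : rel T) (u v : T) (p : seq T) : Prop :=
  [/\ path e u p, last u p = v &
      forall q, path e u q -> last u q = v -> (size p <= size q)%N].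

Section Cacti.
Variable n : nat.
Implicit Types (cA : {set {set 'I_n}}) (a : seq 'I_n) (C : seq (seq 'I_n)).
Implicit Types i j : 'I_n.

Definition vertex : finType := ({set 'I_n} + 'I_n)%type.

Definition cactus_vertices cA : {set vertex} :=
  [set v : vertex | if v is inl A then A \in cA else true].

Definition cactus_edge cA : rel vertex := fun u v =>
  match u, v with
  | inl A, inr j | inr j, inl A => (A \in cA) && (j \in A)
  | _, _ => false
  end.

Definition odd_cactus cA : Prop :=
  (forall A, A \in cA -> odd #|A| /\ (3 <= #|A|)%N) /\
  is_tree (cactus_vertices cA) (cactus_edge cA).

Definition odd_sequence a : bool := [&& uniq a, odd (size a) & 3 <= size a <= n]%N.

Definition support_set a : {set 'I_n} := [set j in a].

(* A finite set of sequences is given by a duplicate-free list of its         *)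
(* elements, i.e. together with an arbitrary ordering; uniq below also says   *)
(* that distinct elements have distinct underlying sets.                      *)
Definition underlying C : {set {set 'I_n}} := [set A in map support_set C].

Definition refined_cactus C : Prop :=
  [/\ all odd_sequence C, uniq (map support_set C) & odd_cactus (underlying C)].

Definition first_label (p : seq vertex) : option 'I_n :=
  ohead (pmap (fun v : vertex => if v is inr j then Some j else None) p).

Definition local_root C i a : 'I_n :=
  classical_sets.xget i (fun j => exists2 p,
    shortest_path (cactus_edge (underlying C)) (inl (support_set a)) (inr i) p
    & first_label p = Some j).

Definition circulation C i a : seq 'I_n :=
  let s := index (local_root C i a) a in drop s.+1 a ++ take s a.

(* The permutation with one-line notation w; it is the identity when w is not *)
(* a listing of 'I_n.                                                         *)
Definition perm_of_seq (w : seq 'I_n) : 'S_n :=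
  odflt 1%g [pick s : 'S_n | codom s == w].

Definition cactus_perm C i : 'S_n :=
  perm_of_seq (i :: flatten (map (circulation C i) C)).

Variables (K : comNzRingType) (y : forall k, k.-tuple 'I_n -> K).

Definition refined_weight i C : K :=
  (-1) ^+ cactus_perm C i * \prod_(a <- C) y (in_tuple a).

(* The common value of all refined weights over cA. *)
Definition cactus_weight cA : K :=
  classical_sets.xget 0 (fun v : K =>
    forall i C, refined_cactus C -> underlying C = cA -> refined_weight i C = v).

(* For n > 0 every odd cactus underlies some refined cactus, so a common      *)
(* value is unique.                                                           *)
Lemma cactus_weightE cA (v : K) : (0 < n)%N -> odd_cactus cA ->
  (forall i C, refined_cactus C -> underlying C = cA -> refined_weight i C = v) ->
  cactus_weight cA = v.
Proof.
move=> n0 hcA hv; apply: classical_sets.xget_unique => // w hw.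
pose C := [seq enum (A : {set 'I_n}) | A <- enum cA].
have supK (A : {set 'I_n}) : support_set (enum A) = A by apply/setP=> j; rewrite inE mem_enum.
have mapC : map support_set C = enum cA.
  by rewrite -map_comp -[RHS]map_id; apply: eq_map => A /=; apply: supK.
have uC : underlying C = cA by apply/setP=> A; rewrite inE mapC mem_enum.
have rC : refined_cactus C.
  split; rewrite ?uC ?mapC ?enum_uniq //.
  apply/allP=> _ /mapP[A AcA ->]; rewrite mem_enum in AcA.
  have [oA A3] := hcA.1 A AcA.
  rewrite /odd_sequence enum_uniq -cardE oA A3 /=.
  by have := max_card (mem A); rewrite card_ord.
by rewrite -(hw (Ordinal n0) C) // (hv (Ordinal n0) C).
Qed.

End Cacti.

(* Main.v *)
(* Let [D] be the odd derivation with [D chi_j = 1] for all [j].  By           *)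

(* Everything rests on factoring [D chi_A] into differences ([boundary_cons]), killed by every
   derivation [gder u] with [u] constant on [A]. Hence [gder u] kills [edge_prod cA] once [u] is
   constant on each hyperedge: [u = 1] moves the root ([berezin_edge_prod_root]), and an indicator
   handles disconnected graphs ([disconnected_berezin]). Dually, [chi_i - chi_j] annihilates
   [edge_prod cA] when [i] and [j] are connected ([connect_edge_prod]), which rules out cycles
   ([linked_edge_prod]). So only odd cacti survive in the expansion of the exponential ([exponentE],
   [gexp_expand]). Basing each factorization at the local root yields one factor
   [chi_b - chi_(parent of b)] for each [b] other than the root, and only the product of the leading
   [chi_b] reaches the top coefficient, with the signature as sign ([berezin_triangular],
   [refined_weightE]). *)
(* antisymmetry the exponent is the sum over odd sets [A] of the terms         *)
(* [y_A D chi_A], which are even, hence central, and have square zero; so the  *)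
(* integral is a sum over sets [cA] of hyperedges of the integral of           *)
(* [chi_i * prod_(A in cA) y_A D chi_A].  As [D] kills the product and the     *)
(* integral of [D f] is zero, applying [D] to [chi_i chi_j P] shows that this  *)
(* does not depend on [i].  Moreover [D chi_A] is the product of the           *)
(* [chi_b - chi_a], [b] in [A] minus [a], for any [a] in [A].  If the graph is *)
(* disconnected, the derivation supported on a component avoiding [i] kills    *)
(* the integrand, whose top coefficient thus vanishes.  If it has a cycle, the *)
(* linear factors are dependent and the product is zero.  For a cactus, taking *)
(* for [a] the local roots makes the linear forms unitriangular, and only the  *)
(* product of the [chi_b] in circulation order contributes.                    *)
From HB Require Import structures.
Require Import Defs.
From mathcomp Require Import all_boot all_order fingroup perm all_algebra.
From mathcomp Require Import boolp.
From mathcomp Require classical_sets.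

Set Implicit Arguments.
Unset Strict Implicit.
Unset Printing Implicit Defensive.

Import GRing.Theory.
Local Open Scope ring_scope.

(* [big_enum] for an operator that need not be commutative. *)
Lemma big_enum_noncomm (R : Type) (op : R -> R -> R) (x : R) (I : finType)
    (A : {pred I}) (F : I -> R) :
  \big[op/x]_(i <- enum A) F i = \big[op/x]_(i in A) F i.
Proof. by rewrite -[RHS]big_filter [index_enum _]unlock /enum_mem. Qed.

(** * Signs in products of anticommuting elements *)

Section Anticommuting.
Variable A : pzRingType.

Lemma prod_anticomm (I : Type) (s : seq I) (x : I -> A) (z : A) :
    (forall i, z * x i = - (x i * z)) ->
  z * \prod_(i <- s) x i = (-1) ^+ size s * (\prod_(i <- s) x i * z).
Proof.
move=> zx; elim: s => [|i s IH]; first by rewrite !big_nil !mul1r mulr1.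
rewrite !big_cons mulrA zx mulNr -mulrA IH /= exprS mulN1r mulNr.
by congr (- _); rewrite !mulrA (commr_sign (x i)).
Qed.

Lemma prod_anticomm_sq (I : eqType) (s : seq I) (x : I -> A) (z : A) (i : I) :
    (forall j, z * x j = - (x j * z)) -> z * x i = 0 -> i \in s ->
  z * \prod_(j <- s) x j = 0.
Proof.
move=> zx zi /splitPr[s1 s2]; rewrite big_cat big_cons /= mulrA prod_anticomm //.
by rewrite -!mulrA [z * (x i * _)]mulrA zi mul0r !mulr0.
Qed.

Lemma perm_lift (k : nat) (s : 'S_k.+1) :
  exists t : 'S_k, s = lift_perm ord0 (s ord0) t.
Proof.
pose f j := odflt j (unlift (s ord0) (s (lift ord0 j))).
have fE j : lift (s ord0) (f j) = s (lift ord0 j).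
  rewrite /f; case: unliftP => [m -> //|/perm_inj/eqP].
  by rewrite eq_sym (negPf (neq_lift _ _)).
have injf : injective f.
  move=> j m /(congr1 (lift (s ord0))); rewrite !fE.
  by move/perm_inj/lift_inj.
exists (perm injf); apply/permP=> j; have [m ->|->] := unliftP ord0 j.
  by rewrite lift_perm_lift permE fE.
by rewrite lift_perm_id.
Qed.

(** [x i] is moved past the [i] factors that precede it, each at the cost of a sign. *)
Lemma prod_bring_front (k : nat) (x : 'I_k.+1 -> A) (i : 'I_k.+1) :
    (forall i j, x i * x j = - (x j * x i)) ->
  x i * \prod_(j < k) x (lift i j) = (-1) ^+ i * \prod_(j < k.+1) x j.
Proof.
elim: k => [|k IH] in x i * => xC.
  by rewrite (ord1 i) big_ord0 big_ord_recl big_ord0 mul1r.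
have [j ->|->] := unliftP ord0 i; last first.
  by rewrite mul1r [RHS]big_ord_recl.
rewrite big_ord_recl [in RHS]big_ord_recl /=.
have -> : lift (lift ord0 j) ord0 = ord0 by apply: val_inj.
rewrite mulrA xC mulNr -mulrA.
under eq_bigr => m _.
  have -> : lift (lift ord0 j) (lift ord0 m) = lift ord0 (lift j m).
    by apply: val_inj; rewrite /= /bump /= !add1n ltnS addnS.
  over.
rewrite (IH (fun m => x (lift ord0 m)) j) => [|? ?]; last exact: xC.
by rewrite mulrA (commr_sign (x ord0)) -mulrA exprS mulN1r mulNr.
Qed.

Lemma prod_perm_sign (k : nat) (x : 'I_k -> A) (s : 'S_k) :
    (forall i j, x i * x j = - (x j * x i)) ->
  \prod_(j < k) x (s j) = (-1) ^+ s * \prod_(j < k) x j.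
Proof.
elim: k => [|k IH] in x s * => xC.
  by rewrite !big_ord0 (_ : s = 1%g) ?odd_perm1 ?mul1r //; apply/permP => -[].
have [t st] := perm_lift s; rewrite big_ord_recl.
have sE j : s (lift ord0 j) = lift (s ord0) (t j) by rewrite {1}st lift_perm_lift.
have -> : s = odd (s ord0) (+) t :> bool by rewrite {1}st odd_lift_perm.
under eq_bigr => j _ do rewrite sE.
rewrite (IH (fun m => x (lift (s ord0) m)) t) => [|? ?]; last exact: xC.
rewrite mulrA (commr_sign (x (s ord0)) t) -mulrA prod_bring_front // mulrA.
by rewrite signr_addb signr_odd (commr_sign ((-1) ^+ t)).
Qed.

Lemma perm_big_comm (I : eqType) (s t : seq I) (x : I -> A) :
    (forall i z, GRing.comm (x i) z) -> perm_eq s t ->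
  \prod_(i <- s) x i = \prod_(i <- t) x i.
Proof.
move=> xC; elim: s t => [|i s IH] t st.
  by move: st; rewrite perm_sym => /perm_nilP ->.
have it : i \in t by rewrite -(perm_mem st) mem_head.
case/splitPr: it st => t1 t2 st; rewrite big_cons big_cat big_cons /=.
rewrite mulrA -[_ * x i]xC -mulrA -big_cat; congr (_ * _); apply: IH.
by rewrite -(perm_cons i) (perm_trans st) // perm_catC /= perm_cons perm_catC.
Qed.

End Anticommuting.

(** * Odd derivations and the boundary of a monomial *)

Section Grassmann.
Variables (K : comNzRingType) (n : nat).
Implicit Types (f g : grassmann K n) (i j : 'I_n) (a b : seq 'I_n).
Implicit Types (S : {set 'I_n}) (u : 'I_n -> K).

Local Notation chi i := (chi i : grassmann K n).

Lemma chi_mono i : chi i = gmono K [set i].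
Proof. by []. Qed.

Lemma chi_sq i : chi i * chi i = 0.
Proof. by rewrite {2}chi_mono mul_chi_gmono inE eqxx. Qed.

Lemma chiC i j : chi i * chi j = - (chi j * chi i).
Proof. by apply/eqP; rewrite -addr_eq0 chi_anticomm. Qed.

Lemma comm_chi f : (forall i, GRing.comm f (chi i)) -> forall g, GRing.comm f g.
Proof.
move=> fC g; rewrite (grassmann_expand g); apply: commr_sum => S _.
rewrite /GRing.comm -scalerAl -scalerAr; congr (_ *: _).
by apply: commr_prod => i _; apply: fC.
Qed.

Definition cprod a : grassmann K n := \prod_(j <- a) chi j.

Lemma chi_cprod i a : chi i * cprod a = (-1) ^+ size a * (cprod a * chi i).
Proof. by rewrite prod_anticomm // => j; apply: chiC. Qed.

Lemma chi_mulE i f S : (chi i * f) S =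
  if i \in S then (-1) ^+ inversions [set i] (S :\ i) * f (S :\ i) else 0.
Proof.
rewrite ffunE; case: ifP => iS; last first.
  rewrite big1 // => I /subsetP sIS; rewrite ffunE; case: eqP => [eI|]; last by rewrite mul0r mulr0.
  by rewrite sIS ?eI ?set11 in iS.
rewrite (bigD1 [set i]) ?sub1set //= big1 ?addr0 => [|I /andP[_ /negPf nI]].
  by rewrite ffunE eqxx mul1r.
by rewrite ffunE nI mul0r mulr0.
Qed.

(** The left derivative in [chi_j]: the sign is that of moving [chi_j] to the front of the monomial
    on [j |: S]. *)
Definition pder j f : grassmann K n := [ffun S : {set 'I_n} =>
  if j \in S then 0 else (-1) ^+ inversions [set j] S * f (j |: S)].

Lemma sign_sq (m : nat) (x : K) : (-1) ^+ m * ((-1) ^+ m * x) = x.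
Proof. by rewrite mulrA -expr2 sqrr_sign mul1r. Qed.

Lemma pder_chi j i f : pder j (chi i * f) = (i == j)%:R *: f - chi i * pder j f.
Proof.
apply/ffunP=> S; rewrite [LHS]ffunE [RHS]ffunE [in RHS]ffunE chi_mulE [X in _ + X]ffunE chi_mulE.
rewrite in_setU1 [pder _ _ _]ffunE !inE; case: (eqVneq i j) => [->|nij] /=.
  rewrite mul1r /=; case: ifP => jS.
    by rewrite setD1K // sign_sq subrr.
  by rewrite setU1K ?jS // sign_sq subr0.
rewrite mul0r add0r /=; case: ifP => jS; case: ifP => iS; rewrite ?mulr0 ?oppr0 //.
have -> : (j |: S) :\ i = j |: (S :\ i).
  by apply/setP=> x; rewrite !inE; case: (x =P i) => [->|//]; rewrite (negPf nij).
have dj : [disjoint [set j] & S :\ i] by rewrite disjoints1 !inE jS andbF.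
have di : [disjoint [set i] & S :\ i] by rewrite disjoints1 !inE eqxx.
rewrite inversionsUr // -[in inversions [set j] S](setD1K iS) inversionsUr //.
rewrite /inversions !big_set1 -/(inversions _ _) !exprD.
have -> : (-1) ^+ (j < i)%N = - (-1) ^+ (i < j)%N :> K.
  by case: ltngtP => [||/val_inj ij]; rewrite ?opprK //; rewrite ij eqxx in nij.
rewrite !mulNr mulrN -!mulrA; congr (- _).
by rewrite [X in _ * X]mulrCA sign_sq mulrCA.
Qed.

Definition gder u f : grassmann K n := \sum_j u j *: pder j f.

Lemma pder_linear j : linear (pder j).
Proof.
move=> c f g; apply/ffunP=> S; rewrite !ffunE; case: ifP => _; first by rewrite mulr0 addr0.
by rewrite mulrDr mulrCA.
Qed.

HB.instance Definition _ j := GRing.isLinear.Build _ _ _ _ (pder j) (pder_linear j).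

Lemma gder_linear u : linear (gder u).
Proof.
move=> c f g; rewrite /gder scaler_sumr -big_split; apply: eq_bigr => j _ /=.
by rewrite pder_linear scalerDr !scalerA mulrC.
Qed.
HB.instance Definition _ u := GRing.isLinear.Build _ _ _ _ (gder u) (gder_linear u).

Lemma gder_chi u i f : gder u (chi i * f) = u i *: f - chi i * gder u f.
Proof.
rewrite /gder mulr_sumr (bigD1 i) //= [in RHS](bigD1 i) //= opprD addrA.
rewrite pder_chi eqxx scale1r scalerBr scalerAr; congr (_ + _); rewrite -sumrN.
apply: eq_bigr => j nj; rewrite pder_chi eq_sym (negPf nj) scale0r add0r.
by rewrite scalerN scalerAr.
Qed.

Lemma gder1 u : gder u 1 = 0.
Proof.
rewrite /gder big1 // => j _; apply/ffunP=> S; rewrite !ffunE.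
case: ifP => _; first by rewrite mulr0.
case: eqP => [/setP/(_ j)|_]; first by rewrite !inE eqxx.
by rewrite !mulr0.
Qed.

Lemma berezin_gder u f : berezin (gder u f) = 0.
Proof. by rewrite /berezin sum_ffunE big1 // => j _; rewrite !ffunE inE mulr0. Qed.

(** At the complement of [i], every [pder j] with [j != i] has coefficient zero, so what is left of
    [gder u f] there is the top coefficient of [f] up to sign. *)
Lemma gder_eq0_berezin u i f : u i = 1 -> gder u f = 0 -> berezin f = 0.
Proof.
move=> ui /ffunP/(_ (setT :\ i)); rewrite sum_ffunE (bigD1 i) //= big1 => [|j ji].
  rewrite !ffunE !inE eqxx /= ui mul1r addr0 setD1K //.
  move/(congr1 ( *%R ((-1) ^+ inversions [set i] (setT :\ i)))).
  by rewrite sign_sq mulr0.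
by rewrite !ffunE !inE ji mulr0.
Qed.

Lemma gder_diff u i j f : u i = u j ->
  gder u ((chi i - chi j) * f) = - ((chi i - chi j) * gder u f).
Proof.
by move=> uij; rewrite !mulrBl raddfB /= !gder_chi uij !opprB addrC addrA subrK.
Qed.

(* [boundary a] is the alternating sum of the products obtained from [a] by   *)
(* deleting one of its entries.                                               *)
Definition boundary a := gder (fun=> 1) (cprod a).

Lemma boundary_cons i a : boundary (i :: a) = \prod_(j <- a) (chi j - chi i).
Proof.
rewrite /boundary /cprod big_cons.
(* As [chi i] has square zero, subtracting it from the later factors changes nothing, and [gder]
   kills each of the new factors. *)
have -> : chi i * \prod_(j <- a) chi j = chi i * \prod_(j <- a) (chi j - chi i).
  elim: a => [|j a IH]; first by rewrite !big_nil.
  by rewrite !big_cons !mulrA mulrBr chi_sq subr0 chiC !mulNr -!mulrA IH.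
rewrite gder_chi scale1r -[RHS]subr0; congr (_ - _).
elim: a => [|j a IH]; first by rewrite big_nil gder1 mulr0.
rewrite big_cons gder_diff // mulrN mulrA mulrBr chi_sq subr0 chiC mulNr opprK.
by rewrite -mulrA IH mulr0.
Qed.

Lemma boundary_comm a f : odd (size a) -> GRing.comm (boundary a) f.
Proof.
case: a => [//|i a] /= /negPf ea; apply: comm_chi => j.
rewrite /GRing.comm boundary_cons [RHS]prod_anticomm => [|k].
  by rewrite -signr_odd ea mul1r.
by rewrite mulrBr mulrBl !(chiC j) opprB opprK addrC.
Qed.

(** The linear factors of the boundary are killed by [gder u], and their number is even, so no sign
    appears. *)
Lemma gder_boundary u a f : odd (size a) -> {in a &, forall i j, u i = u j} ->
  gder u (boundary a * f) = boundary a * gder u f.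
Proof.
case: a => [//|i a] /= ea uC; rewrite boundary_cons.
suff -> : gder u (\prod_(j <- a) (chi j - chi i) * f) =
    (-1) ^+ size a *: (\prod_(j <- a) (chi j - chi i) * gder u f).
  by rewrite -signr_odd (negPf ea) scale1r.
have {ea uC} : {in a, forall j, u j = u i}.
  by move=> j ja; apply: uC; rewrite ?mem_head // mem_behead.
elim: a => [|j a IH] ua; first by rewrite !big_nil !mul1r scale1r.
rewrite !big_cons -!mulrA gder_diff ?ua ?mem_head // IH => [|k ka]; last first.
  by rewrite ua // mem_behead.
by rewrite -scalerAr exprS -scalerA scaleN1r.
Qed.

Lemma chi_cprod_eq0 i a : i \in a -> chi i * cprod a = 0.
Proof. by apply: prod_anticomm_sq; [exact: chiC | exact: chi_sq]. Qed.

(** Up to sign the difference passes inside the derivation, where it kills [cprod a] because both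
    variables occur in it. *)
Lemma diff_boundary i j a : i \in a -> j \in a -> (chi i - chi j) * boundary a = 0.
Proof.
move=> ia ja; apply/eqP; rewrite -oppr_eq0 -gder_diff //.
by rewrite mulrBl !chi_cprod_eq0 // subrr raddf0.
Qed.

Lemma cprod_comm a f : ~~ odd (size a) -> GRing.comm (cprod a) f.
Proof.
move=> /negPf ea; apply: comm_chi => j.
by rewrite /GRing.comm chi_cprod -signr_odd ea mul1r.
Qed.

(** One of the two blocks has even length, hence is central. *)
Lemma cprod_catC a b : odd (size (a ++ b)) -> cprod (a ++ b) = cprod (b ++ a).
Proof.
rewrite size_cat oddD /cprod !big_cat => oab; case oa: (odd (size a)) oab => /= ob.
  by rewrite [RHS]cprod_comm.
by rewrite [LHS]cprod_comm ?oa.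
Qed.

End Grassmann.

(** * Exponential of a sum of central elements of square zero *)

Section Exponential.
Variables (K : comAlgType rat) (n : nat).
Implicit Types (f g x : grassmann K n).

Local Notation invfact p := ((p`!%:R^-1 : rat)%:A : K).

Lemma invfactS p : invfact p.+1 *+ p.+1 = invfact p.
Proof.
rewrite scalerMnl factS natrM invfM -mulr_natl mulrA mulfV ?mul1r //.
by rewrite Num.Theory.pnatr_eq0.
Qed.

Lemma exprD_sq0 f g p : GRing.comm f g -> f * f = 0 ->
  (f + g) ^+ p.+1 = g ^+ p.+1 + (f * g ^+ p) *+ p.+1.
Proof.
move=> fg ff; elim: p => [|p IH]; first by rewrite !expr1 expr0 mulr1 addrC.
rewrite exprS IH mulrDl !mulrDr !mulrnAr !mulrA ff mul0r mul0rn addr0.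
by rewrite -fg -!mulrA -!exprS addrCA -mulrS.
Qed.

Lemma gexpD_sq0 f g : GRing.comm f g -> f * f = 0 -> f set0 = 0 -> g set0 = 0 ->
  gexp (f + g) = (1 + f) * gexp g.
Proof.
(* One extra term, zero by nilpotency, so that removing the term of index 0 leaves as many terms as
   [gexp g] has by definition. *)
move=> fg ff f0 g0; rewrite (@gexpE _ _ n.+2) //; last by rewrite ffunE f0 g0 addr0.
rewrite big_ord_recl /= !expr0 mulrDl mul1r {1}(@gexpE _ _ n.+2 g) //.
rewrite [in RHS]big_ord_recl /= expr0 -!addrA; congr (_ + _).
rewrite /gexp mulr_sumr -big_split /=; apply: eq_bigr => p _.
rewrite /bump /= add1n exprD_sq0 // scalerDr; congr (_ + _).
by rewrite -scalerAr -scalerMnr scalerMnl invfactS.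
Qed.

Lemma gexp0 : gexp (0 : grassmann K n) = 1.
Proof.
rewrite /gexp big_ord_recl big1 => [|p _]; last by rewrite expr0n /= scaler0.
by rewrite addr0 expr0 fact0 invr1 !scale1r.
Qed.

Lemma gexp_sum (I : Type) (s : seq I) (x : I -> grassmann K n) :
    (forall i g, GRing.comm (x i) g) -> (forall i, x i * x i = 0) ->
    (forall i, x i set0 = 0) ->
  gexp (\sum_(i <- s) x i) = \prod_(i <- s) (1 + x i).
Proof.
move=> xC xx x0; elim: s => [|i s IH]; first by rewrite !big_nil gexp0.
rewrite !big_cons gexpD_sq0 ?IH //.
by rewrite sum_ffunE big1.
Qed.

End Exponential.

(** * The exponent as a sum over hyperedges *)

Section Hyperedges.
Variables (K : comAlgType rat) (n : nat) (y : forall k, k.-tuple 'I_n -> K).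
Arguments y : clear implicits.
Hypothesis hy : forall k : nat, odd k -> (3 <= k <= n)%N ->
  completely_antisymmetric (y k).
Implicit Types (i j r : 'I_n) (a b s : seq 'I_n) (A : {set 'I_n}).
Implicit Types (cA : {set {set 'I_n}}).

Local Notation chi i := (chi i : grassmann K n).
Local Notation cprod := (@cprod K n).
Local Notation boundary := (@boundary K n).

Definition yseq a : K := y (size a) (in_tuple a).

Lemma yseqE k (t : k.-tuple 'I_n) : y k t = yseq t.
Proof.
case: t => a e; have ek := eqP e; subst k => /=.
by congr y; apply: val_inj.
Qed.

Definition hsize k := odd k && (3 <= k)%N.

(** A rearrangement multiplies the tensor entry and the monomial by the same sign. *)
Lemma yseq_cprod a b : hsize (size a) -> (size a <= n)%N -> perm_eq a b ->
  yseq a *: cprod a = yseq b *: cprod b.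
Proof.
case/andP=> oa a3 an pab; have sab := perm_size pab.
have := pab; rewrite -{1}[b]/(val (in_tuple b)) => /tuple_permP[p ->].
rewrite -yseqE hy -?sab ?a3 //.
rewrite -/(yseq b) -scalerA [X in _ *: X](_ : _ = (-1) ^+ p *: (yseq b *: cprod b)).
  by rewrite scalerA -expr2 sqrr_sign scale1r.
rewrite scalerA mulrC -scalerA; congr (_ *: _).
rewrite /cprod [in RHS](big_tnth _ _ b) big_map val_ord_tuple big_enum_noncomm /=.
rewrite (@prod_perm_sign _ _ (fun m => chi (tnth (in_tuple b) m)) p) => [|? ?]; last exact: chiC.
by rewrite mulr_sign scaler_sign.
Qed.

(** Transposing two equal entries shows that the value is its own opposite, and 2 is invertible in
    [K]. *)
Lemma yseq_eq0 a : hsize (size a) -> (size a <= n)%N -> ~~ uniq a -> yseq a = 0.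
Proof.
case/andP=> oa a3 an nua; case: a => [//|x0 a] in oa a3 an nua *.
move/(uniqPn x0): nua => [i [j [lij lj e]]].
set b := x0 :: a in oa a3 an lij lj e *.
pose i' := Ordinal (ltn_trans lij lj); pose j' := Ordinal lj.
have nij : i' != j' by rewrite -val_eqE /= neq_ltn lij.
have := hy oa _ (tperm i' j') (in_tuple b); rewrite a3 an odd_tperm nij => /(_ isT).
rewrite expr1 mulN1r.
have -> : [tuple tnth (in_tuple b) (tperm i' j' m) | m < size b] = in_tuple b.
  apply: eq_from_tnth => m; rewrite tnth_mktuple.
  by case: tpermP => [->|->|//]; rewrite !(tnth_nth x0) /= e.
move=> e2; apply: (@two_inj _ K^o); apply/eqP; rewrite addr_eq0; exact/eqP.
Qed.


Definition edge_term A : grassmann K n :=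
  if hsize #|A| then yseq (enum A) *: boundary (enum A) else 0.

Lemma edge_term_comm A f : GRing.comm (edge_term A) f.
Proof.
rewrite /edge_term; case: ifP => [/andP[oA _]|_]; last exact/commr_sym/commr0.
have := @boundary_comm K n (enum A) f; rewrite -cardE => /(_ oA).
by rewrite /GRing.comm -scalerAl -scalerAr => ->.
Qed.

Lemma boundary_sq a : odd (size a) -> (1 < size a)%N -> boundary a * boundary a = 0.
Proof.
case: a => [|i [|j a]] //= oa _; set B := boundary _.
have BE : B = (chi j - chi i) * \prod_(k <- a) (chi k - chi i).
  by rewrite /B boundary_cons big_cons.
rewrite {1}BE -mulrA -[_ * B](@boundary_comm K n [:: i, j & a]) // mulrA.
by rewrite diff_boundary ?mul0r // !inE eqxx ?orbT.
Qed.

Lemma edge_term_sq A : edge_term A * edge_term A = 0.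
Proof.
rewrite /edge_term; case: ifP => [/andP[oA A3]|_]; last by rewrite mul0r.
rewrite -scalerAl -scalerAr boundary_sq -?cardE ?scaler0 //.
exact: ltn_trans A3.
Qed.

Lemma edge_term_set0 A : edge_term A set0 = 0.
Proof.
rewrite /edge_term; case: ifP => [/andP[_]|_]; last by rewrite ffunE.
rewrite cardE ffunE; case: (enum A) => [|i [|j a]] //= _.
rewrite boundary_cons big_cons mulrBl.
by rewrite [X in _ * X]ffunE [X in _ + X]ffunE !chi_mulE !inE subr0 mulr0.
Qed.

Lemma pder_cprod_notin r a : r \notin a -> pder r (cprod a) = 0.
Proof.
elim: a => [_|i a IH].
  rewrite /cprod big_nil; apply/ffunP=> S; rewrite !ffunE; case: ifP => // _.
  case: eqP => [/setP/(_ r)|]; first by rewrite !inE eqxx.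
  by rewrite mulr0.
rewrite inE negb_or => /andP[ri ra]; rewrite /cprod big_cons pder_chi.
by rewrite eq_sym (negPf ri) scale0r IH // mulr0 subr0.
Qed.

(** These are the orderings of [A] that start with [r]; their number cancels the factorial in the
    exponent. *)
Lemma card_uniq_cons_tuples k r A : r \in A -> #|A| = k.+1 ->
  #|[set t : k.-tuple 'I_n | uniq (r :: t) && ([set j in r :: t] == A)]| = k`!.
Proof.
move=> rA cA; have cAr : #|A :\ r| = k.
  by move: cA; rewrite (cardsD1 r) rA => -[].
rewrite -[in RHS]ffactnn -[X in X ^_ _]cAr -card_uniq_tuples.
apply: eq_card => t; rewrite !inE; apply/idP/idP.
  case/andP=> /andP[rt ut] /eqP eA; apply/andP; split=> //.
  apply/allP=> j jt.
  suff : j \in A :\ r by [].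
  rewrite in_setD1 -eA !inE jt orbT andbT.
  by apply: contraNneq rt => <-.
case/andP=> /allP tA ut; have {}tA j : j \in t -> j \in A :\ r by exact: tA.
have rt : r \notin t by apply/negP => /tA; rewrite in_setD1 eqxx.
have urt : uniq (r :: t) by rewrite /= rt.
rewrite urt eqEcard cA cardsE (card_uniqP urt) /= size_tuple leqnn andbT.
apply/subsetP=> j; rewrite !inE => /orP[/eqP->//|/tA].
by rewrite in_setD1 => /andP[].
Qed.

Lemma sum_tuple_cons (V : nmodType) k (F : k.+1.-tuple 'I_n -> V) :
  \sum_(a : k.+1.-tuple 'I_n) F a =
  \sum_(r : 'I_n) \sum_(t : k.-tuple 'I_n) F [tuple of r :: t].
Proof.
rewrite pair_big /= (reindex (fun p : 'I_n * k.-tuple 'I_n => [tuple of p.1 :: p.2])) //=.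
exists (fun a : k.+1.-tuple 'I_n => (thead a, [tuple of behead a])) => [[r t] _|a _] /=.
  by congr pair; apply: val_inj.
by rewrite [RHS]tuple_eta.
Qed.

(* Deleting the head of a sequence is a partial derivative of its product, and *)
(* [yseq a *: cprod a] only depends on the underlying set of [a].             *)
Lemma sum_tuple_edge_term k : hsize k.+1 -> (k < n)%N ->
  \sum_(a : k.+1.-tuple 'I_n) y k.+1 a *: \prod_(j <- behead a) chi j =
  (\sum_(A : {set 'I_n} | #|A| == k.+1) edge_term A) *+ k`!.
Proof.
move=> hk kn; rewrite sum_tuple_cons.
pose h A := yseq (enum A) *: cprod (enum A).
have step r (t : k.-tuple 'I_n) :
    y k.+1 [tuple of r :: t] *: \prod_(j <- t) chi j =
    if uniq (r :: t) then pder r (h [set j in r :: t]) else 0.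
  rewrite yseqE /=; case: ifP => [urt|/negbT nurt]; last first.
    by rewrite yseq_eq0 ?scale0r //= size_tuple.
  rewrite /h -(@yseq_cprod (r :: t)) ?linearZ /= ?size_tuple //; last first.
    apply: uniq_perm; rewrite ?enum_uniq // => j.
    by rewrite mem_enum !inE.
  rewrite /cprod big_cons pder_chi eqxx scale1r.
  case/andP: urt => /= rt _.
  by rewrite [pder _ _](pder_cprod_notin rt) mulr0 subr0.
under eq_bigr => r _ do under eq_bigr => t _ do rewrite [behead _]/= step.
transitivity (\sum_r \sum_(A : {set 'I_n} | #|A| == k.+1)
    \sum_(t : k.-tuple 'I_n | uniq (r :: t) && ([set j in r :: t] == A)) pder r (h A)).
  apply: eq_bigr => r _; rewrite -big_mkcond.
  rewrite (partition_big (fun t : k.-tuple 'I_n => [set j in r :: t])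
    (fun A : {set 'I_n} => #|A| == k.+1)) => [|t urt]; last first.
    by rewrite cardsE (card_uniqP urt) /= size_tuple.
  by apply: eq_bigr => A _; apply: eq_bigr => t /andP[_ /eqP->].
rewrite exchange_big -sumrMnl; apply: eq_bigr => A /eqP cA.
have -> : edge_term A = \sum_r pder r (h A).
  rewrite /edge_term cA hk /boundary -linearZ.
  by apply: eq_bigr => r _; rewrite scale1r.
rewrite -sumrMnl; apply: eq_bigr => r _; rewrite sumr_const.
have [rA|rA] := boolP (r \in A).
  by rewrite -(card_uniq_cons_tuples rA cA) cardsE.
by rewrite linearZ /= pder_cprod_notin ?mem_enum // scaler0 !mul0rn.
Qed.

Lemma exponentE : \sum_(3 <= k < n.+1 | odd k)
    (((k.-1)`!%:R^-1 : rat)%:A : K) *: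
      (\sum_(a : k.-tuple 'I_n) y k a *: \prod_(j <- behead a) chi j) =
  \sum_A edge_term A.
Proof.
transitivity (\sum_(3 <= k < n.+1 | odd k) \sum_(A : {set 'I_n} | #|A| == k) edge_term A).
  rewrite big_nat_cond [RHS]big_nat_cond; apply: eq_bigr => -[|k] /andP[/andP[k3 kn] ok] //.
  rewrite sum_tuple_edge_term ?/hsize ?ok // -scalerMnr scalerMnl.
  rewrite scalerMnl -mulr_natl divff ?scale1r //.
  by rewrite Num.Theory.pnatr_eq0 -lt0n fact_gt0.
rewrite (exchange_big_dep predT) //=; apply: eq_bigr => A _.
have [hA|/negbTE hA] := boolP (hsize #|A|); last first.
  by rewrite /edge_term hA big1.
rewrite (big_rem #|A|) /=; last first.
  rewrite mem_index_iota; case/andP: hA => _ ->; rewrite ltnS.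
  by have := max_card (mem A); rewrite card_ord.
case/andP: (hA) => -> _; rewrite eqxx /= big_seq_cond big1 ?addr0 // => k.
by rewrite mem_rem_uniq ?iota_uniq // => /and3P[/andP[/= nk _] _ /eqP ek]; rewrite ek eqxx in nk.
Qed.

Definition edge_prod cA : grassmann K n := \prod_(A in cA) edge_term A.

Lemma gexp_expand : gexp (\sum_A edge_term A) = \sum_cA edge_prod cA.
Proof.
rewrite gexp_sum; [|exact: edge_term_comm|exact: edge_term_sq|exact: edge_term_set0].
under eq_bigr => A _ do rewrite addrC.
rewrite bigA_distr; apply: eq_bigr => cA _.
by rewrite /edge_prod [RHS]big_mkcond.
Qed.

End Hyperedges.

(** * Cycles seen from one of their hyperedges *)

Section CactusGraph.
Variable n : nat.
Implicit Types (cA : {set {set 'I_n}}) (A : {set 'I_n}) (i j k : 'I_n).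
Implicit Types (u v : vertex n) (p q : seq (vertex n)).

Lemma cactus_edge_sym cA : symmetric (cactus_edge cA).
Proof. by case=> [A|j] [B|k]. Qed.

Lemma connect_cactus_sym cA : connect_sym (cactus_edge cA).
Proof. by apply: sym_connect_sym; apply: cactus_edge_sym. Qed.

Lemma path_setD1 cA A u p : path (cactus_edge cA) u p -> inl A \notin u :: p ->
  path (cactus_edge (cA :\ A)) u p.
Proof.
elim: p u => //= v p IH u /andP[uv vp]; rewrite !inE !negb_or => /and3P[Au Av Ap].
rewrite IH ?inE ?negb_or ?Av // andbT.
case: u v uv Au Av {vp IH} => [B|j] [C|k] //=; rewrite in_setD1 => /andP[-> ->] + +.
  by move=> BA _; rewrite !andbT; apply: contraNneq BA => ->.
by move=> _ CA; rewrite !andbT; apply: contraNneq CA => ->.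
Qed.

Lemma path_inl_mem cA A u p : path (cactus_edge cA) u p -> inl A \in p -> A \in cA.
Proof.
elim: p u => //= v p IH u /andP[uv vp]; rewrite inE => /orP[/eqP ev|]; last exact: IH vp.
by move: uv; rewrite -ev; case: u => [//|j] /= /andP[].
Qed.

(* Such a pair exists if and only if the graph has a cycle.                   *)
Definition linked cA A j k := [/\ A \in cA, j \in A, k \in A, j != k &
  connect (cactus_edge (cA :\ A)) (inr j) (inr k)].

(** Rotated to start at a hyperedge [A], the cycle leaves and re-enters [A] through distinct [j] and
    [k], which its remainder joins without meeting [A]. *)
Lemma ucycle_linked cA p : ucycle (cactus_edge cA) p -> (2 < size p)%N ->
  exists A j k, linked cA A j k.
Proof.
move=> cp p3; have [A Ap] : exists A, inl A \in p.
  case: p cp p3 => [//|u [//|v p]] /andP[/= /andP[uv _] _] _.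
  case: u v uv => [A|j] [B|k] //= _; first by exists A; rewrite mem_head.
  by exists B; rewrite !inE eqxx orbT.
have [m q Eq] := rot_to Ap.
have sq : (2 < size (inl A :: q))%N by rewrite -Eq size_rot.
rewrite -(rot_ucycle m) Eq in cp.
case/andP: cp; case: q sq {Eq} => [//|[B|j] q] //= q0.
rewrite rcons_path => /andP[/andP[AcA jA] /andP[jq lastA]] /and3P[Aq jnq _].
case: q => [//|v q] in q0 jq lastA Aq jnq *.
move: lastA; rewrite /=; case lv: (last v q) => [//|k] /andP[_ kA].
exists A, j, k; split=> //.
  by apply: contraNneq jnq => jk; rewrite -jk in lv; rewrite -lv mem_last.
apply/connectP; exists (v :: q); [exact: path_setD1 | by rewrite /= lv].
Qed.

Lemma linked_ucycle cA A j k : linked cA A j k ->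
  exists2 p, (2 < size p)%N & ucycle (cactus_edge cA) p.
Proof.
case=> AcA jA kA njk /connectP[p pj].
case/shortenP: pj => q jq uq _ lastq.
have Aq : inl A \notin q.
  by apply/negP => /(path_inl_mem jq); rewrite in_setD1 eqxx.
exists (inl A :: inr j :: q).
  by case: q lastq {jq uq Aq} => [[ejk]|//]; rewrite ejk eqxx in njk.
apply/andP; split; last by rewrite cons_uniq inE Aq.
rewrite /= rcons_path AcA jA -lastq /= AcA kA andbT.
rewrite andbT; apply: sub_path jq => -[B|l] [C|m] //=; rewrite in_setD1.
  by case/andP=> /andP[_ ->].
by case/andP=> /andP[_ ->].
Qed.

End CactusGraph.

(** * Independence of the root, and vanishing away from odd cacti *)

Section Vanishing.
Variables (K : comAlgType rat) (n : nat) (y : forall k, k.-tuple 'I_n -> K).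
Arguments y : clear implicits.
Hypothesis hy : forall k : nat, odd k -> (3 <= k <= n)%N ->
  completely_antisymmetric (y k).
Implicit Types (i j k : 'I_n) (a b s : seq 'I_n) (A : {set 'I_n}).
Implicit Types (cA : {set {set 'I_n}}).

Local Notation chi i := (chi i : grassmann K n).
Local Notation boundary := (@boundary K n).
Local Notation yseq := (yseq y).
Local Notation edge_term := (edge_term y).
Local Notation edge_prod := (edge_prod y).

Lemma edge_prod_perm cA (s : seq {set 'I_n}) : perm_eq (enum cA) s ->
  edge_prod cA = \prod_(A <- s) edge_term A.
Proof.
rewrite /edge_prod -big_enum_noncomm; apply: perm_big_comm.
by move=> A f; apply: edge_term_comm.
Qed.

Lemma edge_prod_setD1 A cA : A \in cA ->
  edge_prod cA = edge_term A * edge_prod (cA :\ A).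
Proof.
move=> AcA; rewrite (@edge_prod_perm cA (A :: enum (cA :\ A))).
  by rewrite big_cons /edge_prod -big_enum_noncomm.
apply: uniq_perm; rewrite /= ?enum_uniq ?mem_enum ?in_setD1 ?eqxx // => B.
by rewrite !inE !mem_enum in_setD1; case: eqP => [->|].
Qed.

Lemma edge_prod_comm cA f : GRing.comm (edge_prod cA) f.
Proof. by apply/commr_sym/commr_prod => A _; apply/commr_sym/edge_term_comm. Qed.

Lemma diff_edge_term A i j : i \in A -> j \in A -> (chi i - chi j) * edge_term A = 0.
Proof.
move=> iA jA; rewrite /edge_term; case: ifP => _; last by rewrite mulr0.
by rewrite -scalerAr diff_boundary ?mem_enum // scaler0.
Qed.

Lemma gder_edge_prod u cA :
  (forall A, A \in cA -> {in A &, forall i j, u i = u j}) -> gder u (edge_prod cA) = 0.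
Proof.
rewrite /edge_prod -big_enum_noncomm => uA.
have {uA} : {in enum cA, forall A, {in A &, forall i j, u i = u j}}.
  by move=> A; rewrite mem_enum; apply: uA.
elim: (enum cA) => [|A s IH] us; first by rewrite big_nil gder1.
rewrite big_cons {1}/edge_term; case: ifP => [/andP[oA _]|_]; last by rewrite mul0r raddf0.
rewrite -scalerAl linearZ /= gder_boundary ?IH ?mulr0 ?scaler0 -?cardE //.
  by move=> B Bs; apply: us; rewrite inE Bs orbT.
by move=> i j; rewrite !mem_enum; apply: us; rewrite mem_head.
Qed.

(** Applying [gder (fun=> 1)] to [chi i * (chi j * P)], with [P] the edge product, gives
    [chi j * P - chi i * P], and a derivative has zero integral. *)
Lemma berezin_edge_prod_root cA i j :
  berezin (chi i * edge_prod cA) = berezin (chi j * edge_prod cA).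
Proof.
apply/eqP; rewrite eq_sym -subr_eq0; apply/eqP.
rewrite -[RHS](berezin_gder (fun=> 1) (chi i * (chi j * edge_prod cA))).
by rewrite !gder_chi gder_edge_prod // mulr0 subr0 !scale1r /berezin !ffunE.
Qed.

Lemma connect_edge_prod cA i j : connect (cactus_edge cA) (inr i) (inr j) ->
  (chi i - chi j) * edge_prod cA = 0.
Proof.
(* The invariant along a walk: at a hyperedge it speaks of all members, since a walk may enter and
   leave through different ones. *)
pose Q (v : vertex n) := forall j,
  match v with inl A => j \in A | inr k => j == k end ->
  (chi i - chi j) * edge_prod cA = 0.
have step u v : cactus_edge cA u v -> Q u -> Q v.
  case: u v => [A|k] [B|l] //= /andP[AcA lA] Qu m.
    by move/eqP->; apply: Qu.
  move=> mB; rewrite -[chi i - chi m](subrKA (chi k)).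
  rewrite mulrDl Qu //= add0r (edge_prod_setD1 AcA) mulrA.
  by rewrite diff_edge_term ?mul0r.
case/connectP=> p; have : Q (inr i) by move=> l /eqP->; rewrite subrr mul0r.
elim: p (inr i : vertex n) => [|v p IH] u Qu /=; first by move=> _ e; apply: Qu; rewrite -e.
by case/andP=> uv; apply: IH; apply: step Qu.
Qed.

Lemma linked_edge_prod cA A j k : linked cA A j k -> edge_prod cA = 0.
Proof.
case=> AcA jA kA njk jk; rewrite (edge_prod_setD1 AcA) /edge_term.
case: ifP => [hA|_]; last by rewrite mul0r.
(* Listing [k] and [j] first makes [chi j - chi k] a factor of the boundary; the other hyperedges,
   which still connect [j] to [k], kill it. *)
set a := [:: k, j & enum (A :\ j :\ k)].
have -> : yseq (enum A) *: boundary (enum A) = yseq a *: boundary a.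
  rewrite /boundary -!linearZ; congr gder.
  apply: yseq_cprod => //; rewrite -?cardE //.
    by have := max_card (mem A); rewrite card_ord.
  apply: uniq_perm; rewrite ?enum_uniq //= ?inE ?mem_enum ?inE ?eqxx ?andbF //=.
    by rewrite orbF eq_sym njk enum_uniq.
  move=> l; rewrite !inE !mem_enum !inE.
  by case: (l =P k) => [->|_] //=; case: (l =P j) => [->|].
rewrite /a boundary_cons big_cons -!scalerAl -mulrA.
have := edge_prod_comm (cA :\ A); rewrite /GRing.comm => PC.
by rewrite -PC mulrA connect_edge_prod // mul0r scaler0.
Qed.

Lemma disconnected_berezin cA i j : ~~ connect (cactus_edge cA) (inr i) (inr j) ->
  berezin (chi i * edge_prod cA) = 0.
Proof.
(* The indicator of the vertices outside the component of [i] is constant on each hyperedge, 0 at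
   [i] and 1 at [j]. *)
move=> nij; pose u k : K := (~~ connect (cactus_edge cA) (inr i) (inr k))%:R.
apply: (@gder_eq0_berezin _ _ u j); first by rewrite /u nij.
rewrite gder_chi gder_edge_prod ?mulr0 ?subr0 /u ?connect0 ?scale0r // => A AcA k l kA lA.
congr (~~ _)%:R; apply: same_connect_r; first exact: connect_cactus_sym.
by apply: (@connect_trans _ _ (inl A)); apply: connect1; rewrite /= AcA.
Qed.

Lemma edge_term_not_hsize A : ~~ hsize #|A| -> edge_term A = 0.
Proof. by rewrite /edge_term => /negPf->. Qed.

Lemma not_cactus_berezin cA i : ~ odd_cactus cA -> berezin (chi i * edge_prod cA) = 0.
Proof.
move=> ncA; apply/eqP; apply: contra_notT ncA => /eqP W.
have W0 : edge_prod cA <> 0 by move=> P0; apply: W; rewrite P0 mulr0 /berezin ffunE.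
have hA A : A \in cA -> hsize #|A|.
  move=> AcA; apply: contra_notT W0 => /edge_term_not_hsize A0.
  by rewrite (edge_prod_setD1 AcA) A0 mul0r.
split=> [A /hA/andP//|]; split=> [u v|p p3 cp].
  have root w : w \in cactus_vertices cA -> connect (cactus_edge cA) w (inr i).
    rewrite connect_cactus_sym inE.
    have ij j : connect (cactus_edge cA) (inr i) (inr j).
      by apply: contra_notT W; apply: disconnected_berezin.
    case: w => [A AcA|j _]; last exact: ij.
    have /andP[_ A3] := hA A AcA.
    have /card_gt0P[j jA] : (0 < #|A|)%N by apply: leq_trans A3.
    by apply: (connect_trans (ij j)); apply: connect1; rewrite /= AcA.
  by move=> /root iu /root; rewrite connect_cactus_sym; apply: connect_trans.
by have [A [j [k /linked_edge_prod]]] := ucycle_linked cp p3.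
Qed.

End Vanishing.

(** * The integral of a unitriangular product of linear forms *)

Section Triangular.
Variables (K : comNzRingType) (n : nat).

Lemma cprod_eq0 (a : seq 'I_n) : ~~ uniq a -> cprod K a = 0.
Proof.
elim: a => //= i a IH; rewrite /cprod big_cons negb_and negbK => /orP[ia|/IH a0].
  exact: chi_cprod_eq0.
by rewrite -/(cprod K a) a0 mulr0.
Qed.

(* In the expansion of the product, a choice other than all [chi (s j)] takes *)
(* some [chi (par b)] twice: take [b] of least depth among the wrong choices. *)
Lemma berezin_triangular (s : 'S_n) (par : 'I_n -> 'I_n) (u : 'I_n -> K)
    (d : 'I_n -> nat) : (forall b, u b != 0 -> (d (par b) < d b)%N) ->
  berezin (\prod_(j < n) (chi (s j) + u (s j) *: chi (par (s j)))) = (-1) ^+ s.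
Proof.
move=> du; rewrite bigA_distr (bigD1 setT) //= [X in _ + X]big1 => [|J nJ].
  rewrite addr0; under eq_bigr => j _ do rewrite inE.
  rewrite (@prod_perm_sign _ _ (fun j => chi j) s) => [|i j]; last exact: chiC.
  have -> : \prod_(j < n) chi j = gmono K [set: 'I_n].
    rewrite gmono_chi big_enum_noncomm; apply: eq_bigl => j.
    by rewrite inE.
  by rewrite mulr_sign -scaler_sign /berezin !ffunE eqxx mulr1.
have [j0 nj0] : exists j0, j0 \notin J.
  by have := nJ; rewrite -subTset => /subsetPn[j _ nj]; exists j.
have [j njJ jmin] := @arg_minnP _ j0 (fun j => j \notin J) (fun j => d (s j)) nj0.
pose c m := if m \in J then 1 else u (s m).
pose f m := if m \in J then s m else par (s m).
rewrite (eq_bigr (fun m => c m *: (chi (f m) : grassmann K n))); last first.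
  by move=> m _; rewrite /c /f; case: ifP; rewrite ?scale1r.
rewrite scaler_prod; have [u0|/du dj] := eqVneq (u (s j)) 0.
  by rewrite (bigD1 j) //= {1}/c (negPf njJ) u0 mul0r scale0r.
suff /cprod_eq0 E : ~~ uniq [seq f m | m <- enum 'I_n].
  by move: E; rewrite /cprod big_map big_enum_noncomm => ->; rewrite scaler0.
apply/negP => /injectiveP inj_f.
pose j' := (s^-1)%g (par (s j)).
have sj' : s j' = par (s j) by rewrite permKV.
have j'J : j' \in J.
  by apply: contraLR dj => /jmin; rewrite sj' -leqNgt.
have /inj_f ejj' : f j = f j' by rewrite /f (negPf njJ) j'J sj'.
by rewrite ejj' j'J in njJ.
Qed.

End Triangular.

(** * Shortest paths *)

Section ShortestPaths.
Variables (T : finType) (e : rel T).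
Implicit Types (u v w : T) (p q : seq T).

Lemma ex_shortest_path u v : connect e u v -> exists p, shortest_path e u v p.
Proof.
case/connectP=> p up lp.
pose P m := `[< exists q, [/\ size q = m, path e u q & last u q = v] >].
have exP : exists m, P m by exists (size p); apply/asboolP; exists p.
case: (ex_minnP exP) => m /asboolP[q [<- uq lq]] qmin; exists q; split=> // q' uq' lq'.
by apply: qmin; apply/asboolP; exists q'.
Qed.

Lemma shortest_path_behead u v w p :
  shortest_path e u v (w :: p) -> e u w /\ shortest_path e w v p.
Proof.
case=> /= /andP[uw wp] lp pmin; split=> //; split=> // q wq lq.
by apply: (pmin (w :: q)) => //=; rewrite uw.
Qed.

(** If [q] met [u], its tail from there would be a path to [v] shorter than [p]. *)
Lemma shortest_path_notin u v w p q : shortest_path e u v p -> path e w q ->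
  last w q = v -> (size q <= size p)%N -> u \notin q.
Proof.
case=> _ _ pmin wq lq qp; apply/negP => uq; case/splitPr: q / uq wq lq qp => q1 q2.
rewrite cat_path last_cat /= => /and3P[_ _ uq2] lq2.
rewrite size_cat /= leqNgt => /negP; apply.
by rewrite (leq_ltn_trans (pmin _ uq2 lq2)) // addnS ltnS leq_addl.
Qed.

End ShortestPaths.

(** * Local roots, parents and depth in a rooted cactus *)

Section RootedCactus.
Variables (n : nat) (cA : {set {set 'I_n}}) (i : 'I_n).
Hypothesis hcA : odd_cactus cA.
Implicit Types (A B : {set 'I_n}) (b r : 'I_n) (p q : seq (vertex n)).

Local Notation e := (cactus_edge cA).

Lemma cactus_not_linked A b r : ~ linked cA A b r.
Proof. by move=> /linked_ucycle[p p3]; apply: hcA.2.2. Qed.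

Lemma cactus_connect u : u \in cactus_vertices cA -> connect e u (inr i).
Proof. by move=> uV; apply: hcA.2.1 => //; rewrite inE. Qed.

Definition edge_root A r :=
  exists p, shortest_path e (inl A) (inr i) (inr r :: p).

Lemma ex_edge_root A : A \in cA -> exists p r, shortest_path e (inl A) (inr i) (inr r :: p).
Proof.
move=> AcA; have /ex_shortest_path[p sp] : connect e (inl A) (inr i).
  by apply: cactus_connect; rewrite inE.
case: p sp => [[]//|[B|r] p] sp; last by exists p, r.
by case/shortest_path_behead: sp.
Qed.

Lemma edge_root_mem A r : edge_root A r -> A \in cA /\ r \in A.
Proof. by case=> p /shortest_path_behead[/andP[]]. Qed.

Lemma edge_root_connect A r : edge_root A r ->
  connect (cactus_edge (cA :\ A)) (inr r) (inr i).
Proof.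
case=> p sp; have [_ [rp lp _]] := shortest_path_behead sp.
apply/connectP; exists p => //; apply: path_setD1 => //.
by rewrite inE negb_or /= (shortest_path_notin sp rp lp).
Qed.

(** Otherwise [b] and [r], joined without [A], would close a cycle through [A]. *)
Lemma edge_root_unique A r b : edge_root A r -> b \in A ->
  connect (cactus_edge (cA :\ A)) (inr b) (inr i) -> b = r.
Proof.
move=> Ar bA bi; apply: contra_notP (@cactus_not_linked A b r) => /eqP nbr.
have [AcA rA] := edge_root_mem Ar; split=> //; apply: connect_trans bi _.
by rewrite connect_cactus_sym edge_root_connect.
Qed.

(** Say [B] is at least as close to [i] as [A]. If they differ, a shortest path from [B] avoids [A],
    so [b] reaches [i] through [B] without [A] and is therefore the local root of [A]. *)
Lemma parent_edge_unique A B r r' b : edge_root A r -> edge_root B r' ->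
  b \in A -> b \in B -> b != r -> b != r' -> A = B.
Proof.
wlog : A B r r' / forall p q, shortest_path e (inl A) (inr i) p ->
    shortest_path e (inl B) (inr i) q -> (size q <= size p)%N.
  move=> WL Ar Br' bA bB br br'; case: (Ar) (Br') => p sp [q sq].
  have same (C : {set 'I_n}) p1 p2 : shortest_path e (inl C) (inr i) p1 ->
      shortest_path e (inl C) (inr i) p2 -> size p1 = size p2.
    case=> u1 l1 m1 [u2 l2 m2]; apply/eqP; rewrite eqn_leq m1 //=.
    exact: m2.
  case: (leqP (size (inr r' :: q)) (size (inr r :: p))) => [qp|/ltnW pq].
    apply: (WL A B r r') => // p1 q1 /(same _ _ _ sp) <- /(same _ _ _ sq) <-.
    exact: qp.
  apply/esym; apply: (WL B A r' r) => // p1 q1 /(same _ _ _ sq) <- /(same _ _ _ sp) <-.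
  exact: pq.
move=> le Ar Br' bA bB br br'; apply: contraNeq br => nAB; apply/eqP.
apply: (edge_root_unique Ar bA); case: (Ar) (Br') => p sp [q sq].
have [uq lq _] := sq; have [BcA _] := edge_root_mem Br'.
have nA : inl A \notin [:: inl B, inr r' & q].
  rewrite inE negb_or (shortest_path_notin sp uq lq) ?(le _ _ sp sq) // andbT.
  by apply: contraNneq nAB => -[->].
apply: (@connect_trans _ _ (inl B)).
  by apply: connect1; rewrite /= in_setD1 bB BcA eq_sym nAB.
by apply/connectP; exists (inr r' :: q) => //; apply: path_setD1 nA.
Qed.

(* [parent b r]: [r] is the local root of a hyperedge in whose circulation [b] *)
(* occurs.                                                                    *)
Definition parent b r := exists A, [/\ edge_root A r, b \in A & b != r].

Lemma parent_unique b r r' : parent b r -> parent b r' -> r = r'.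
Proof.
case=> A [Ar bA br] [B [Br' bB br']].
have eAB := parent_edge_unique Ar Br' bA bB br br'; subst B.
by have [_ rA] := edge_root_mem Ar; apply: edge_root_unique Br' rA (edge_root_connect Ar).
Qed.

Lemma parent_neq_root b r : parent b r -> b != i.
Proof.
case=> A [Ar bA br]; apply: contraNneq br => bi; rewrite bi in bA *.
by apply/eqP/(edge_root_unique Ar bA)/connect0.
Qed.

(** The depth is the distance to [i]: a shortest path from [b] begins with a hyperedge followed by
    its local root, which is nearer to [i]. *)
Lemma ex_depth : exists d : 'I_n -> nat,
  forall b, b != i -> exists2 r, parent b r & (d r < d b)%N.
Proof.
have /choice[sp spP] b : exists p, shortest_path e (inr b) (inr i) p.
  by apply: ex_shortest_path; apply: cactus_connect; rewrite inE.
exists (fun b => size (sp b)) => b nbi.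
have := spP b; case: (sp b) => [[_ [bi]]|[A|//] p spb].
- by rewrite bi eqxx in nbi.
- have [/= /andP[AcA bA] spA] := shortest_path_behead spb.
  case: p spb spA => [|[B|r] p] spb spA; [by case: spA| by case/shortest_path_behead: spA|].
  have [_ spr] := shortest_path_behead spA; exists r; last first.
    have [[_ _ rmin] [rp lp _]] := (spP r, spr).
    by apply: leq_ltn_trans (rmin _ rp lp) _; rewrite /= ltnS leqnSn.
  exists A; split=> //; first by exists p.
  apply/eqP => br; subst r; have [rp lp _] := spr; case: spb => _ _ /(_ _ rp lp).
  by rewrite /= ltnNge ltnW.
by case/shortest_path_behead.
Qed.

End RootedCactus.

Lemma uniq_flatten_map (S T : eqType) (s : seq S) (f : S -> seq T) : uniq s ->
    {in s, forall x, uniq (f x)} ->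
    {in s &, forall x x' z, z \in f x -> z \in f x' -> x = x'} ->
  uniq (flatten (map f s)).
Proof.
elim: s => //= x s IH /andP[xs us] uf inj; rewrite cat_uniq uf ?mem_head //=.
rewrite IH ?andbT //.
- apply/hasPn => z /flatten_mapP[x' x's zx']; apply/negP => zx.
  by move: xs; rewrite (inj x x' _ _ z) ?x's ?mem_head // inE x's orbT.
- by move=> x' x's; apply: uf; rewrite inE x's orbT.
by move=> x1 x2 s1 s2; apply: inj; rewrite inE ?s1 ?s2 orbT.
Qed.

Lemma map_uniq_inj (S T : eqType) (s : seq S) (f : S -> T) : uniq (map f s) ->
  {in s &, injective f}.
Proof.
elim: s => //= x s IH /andP[fx us] x1 x2; rewrite !inE.
case/predU1P=> [->|s1] /predU1P[->|s2] // e; last exact: IH.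
  by rewrite e map_f in fx.
by rewrite -e map_f in fx.
Qed.

Lemma perm_of_seqP n (w : seq 'I_n) : uniq w -> (forall i, i \in w) ->
  codom (perm_of_seq w) = w.
Proof.
move=> uw wT; rewrite /perm_of_seq; case: pickP => [s /eqP //|noperm].
have /tuple_permP[s ws] : perm_eq w (ord_tuple n).
  apply: uniq_perm; rewrite ?val_ord_tuple ?enum_uniq // => i.
  by rewrite wT mem_enum.
have := noperm s; rewrite [X in _ == X]ws; case: eqP => // -[].
apply: eq_map => i.
by rewrite tnth_ord_tuple.
Qed.

(** * The refined weight as a Berezin integral *)

Section RefinedWeight.
Variables (K : comAlgType rat) (n : nat) (y : forall k, k.-tuple 'I_n -> K).
Arguments y : clear implicits.
Hypothesis hy : forall k : nat, odd k -> (3 <= k <= n)%N ->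
  completely_antisymmetric (y k).
Variables (i : 'I_n) (C : seq (seq 'I_n)).
Hypothesis rC : refined_cactus C.
Implicit Types (b r : 'I_n) (a : seq 'I_n).

Local Notation chi i := (chi i : grassmann K n).
Local Notation boundary := (@boundary K n).
Local Notation yseq := (yseq y).
Local Notation edge_term := (edge_term y).
Local Notation edge_prod := (edge_prod y).
Local Notation cA := (underlying C).
Local Notation root a := (local_root C i a).
Local Notation circ a := (circulation C i a).

Let hcA : odd_cactus cA. Proof. by case: rC. Qed.

Lemma mem_underlying a : a \in C -> support_set a \in cA.
Proof. by move=> aC; rewrite inE map_f. Qed.

Lemma local_rootP a : a \in C -> edge_root cA i (support_set a) (root a).
Proof.
move=> /mem_underlying /(ex_edge_root i hcA)[p0 [r0 sp0]]; rewrite /local_root.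
case: classical_sets.xgetP => [r _ [p sp]|/(_ r0)]; last first.
  by case; exists (inr r0 :: p0).
case: p sp => [[]//|[B|r'] p] sp /=; first by case/shortest_path_behead: sp.
by case=> <-; exists p.
Qed.

Lemma refined_odd_sequence a : a \in C ->
  [/\ uniq a, hsize (size a), (size a <= n)%N & root a \in a].
Proof.
move=> aC; case: rC => /allP/(_ a aC) /and3P[ua oa /andP[a3 an]] _ _.
split=> //; first by rewrite /hsize oa.
by have [_] := edge_root_mem (local_rootP aC); rewrite inE.
Qed.

(** [root a :: circ a] is a rotation of [a], and rotating a product of odd length costs no sign. *)
Lemma circulation_perm a : a \in C ->
  perm_eq a (root a :: circ a) /\ cprod K a = cprod K (root a :: circ a).
Proof.
move=> aC; have [ua /andP[oa _] _ ra] := refined_odd_sequence aC.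
have aE : a = take (index (root a) a) a ++ root a :: drop (index (root a) a).+1 a.
  by rewrite -{2}(nth_index i ra) -drop_nth ?index_mem // cat_take_drop.
split; first by rewrite {1}aE perm_catC.
by rewrite {1}aE cprod_catC // -aE.
Qed.

Lemma mem_circulation a b : a \in C -> b \in circ a ->
  [/\ b \in a, b != root a & parent cA i b (root a)].
Proof.
move=> aC bc; have [pa _] := circulation_perm aC.
have [ua _ _ _] := refined_odd_sequence aC.
have ba : b \in a by rewrite (perm_mem pa) inE bc orbT.
have nb : b != root a.
  by move: ua; rewrite (perm_uniq pa) /= => /andP[+ _]; apply: contraNneq => <-.
by split=> //; exists (support_set a); split; rewrite ?inE //; apply: local_rootP.
Qed.

(** Circulations are disjoint by [parent_edge_unique] and avoid [i]; every other [b] occurs in one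
    because [ex_depth] gives it a parent. *)
Lemma cactus_perm_codom :
  codom (cactus_perm C i) = i :: flatten (map (circulation C i) C).
Proof.
have uC : uniq C by case: rC => _ /map_uniq.
have injC : {in C &, injective (@support_set n)}.
  by apply: map_uniq_inj; case: rC.
apply: perm_of_seqP.
  rewrite /= uniq_flatten_map ?andbT //.
  - apply/negP => /flatten_mapP[a aC /(mem_circulation aC)[_ _]].
    by move/(parent_neq_root hcA); rewrite eqxx.
  - move=> a aC; have [pa _] := circulation_perm aC.
    have [ua _ _ _] := refined_odd_sequence aC.
    by move: ua; rewrite (perm_uniq pa) => /andP[].
  move=> a a' aC a'C b /(mem_circulation aC)[ba bra _] /(mem_circulation a'C)[ba' bra' _].
  apply: injC => //; apply: (parent_edge_unique hcA (local_rootP aC) (local_rootP a'C) _ _ bra bra');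
    by rewrite inE.
move=> b; rewrite inE; have [//|nbi /=] := eqVneq b i.
have [d /(_ b nbi)[r [A [Ar bA br]] _]] := ex_depth i hcA.
have [AcA _] := edge_root_mem Ar.
move: AcA; rewrite inE => /mapP[a aC eA]; subst A.
apply/flatten_mapP; exists a => //.
have [pa _] := circulation_perm aC.
have : b \in a by rewrite inE in bA.
rewrite (perm_mem pa) inE => /orP[/eqP bra|//].
have rE : root a = r.
  have [_ ra] := edge_root_mem (local_rootP aC).
  exact: (edge_root_unique hcA Ar ra (edge_root_connect (local_rootP aC))).
by rewrite bra rE eqxx in br.
Qed.

(** With the local root as base point, [a] contributes [yseq a] times the factors
    [chi b - chi (par b)] in circulation order. Preceded by [chi i], these form the product of
    [berezin_triangular] for [cactus_perm C i]. *)
Lemma refined_weightE : refined_weight y i C = berezin (chi i * edge_prod cA).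
Proof.
have [d dP] := ex_depth i hcA.
have /choice[par parP] b : exists r, b != i -> parent cA i b r /\ (d r < d b)%N.
  have [->|/dP[r br dr]] := eqVneq b i; [by exists i | by exists r].
rewrite (@edge_prod_perm _ _ y cA (map (@support_set n) C)); last first.
  apply: uniq_perm; rewrite ?enum_uniq //; first by case: rC.
  by move=> A; rewrite mem_enum inE.
have termE a : a \in C ->
    edge_term (support_set a) = yseq a *: \prod_(b <- circ a) (chi b - chi (par b)).
  move=> aC; have [ua ha an _] := refined_odd_sequence aC.
  have ea : perm_eq a (enum (support_set a)).
    by apply: uniq_perm; rewrite ?enum_uniq // => b; rewrite mem_enum inE.
  rewrite /edge_term cardE -(perm_size ea) ha.
  transitivity (yseq a *: boundary a).
    by rewrite /boundary -!linearZ; congr gder; rewrite (yseq_cprod hy ha an ea).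
  have [_ E] := circulation_perm aC; rewrite /boundary E.
  rewrite -/(boundary _) boundary_cons; congr (_ *: _).
  rewrite [LHS]big_seq [RHS]big_seq; apply: eq_bigr => b bc.
  have [_ _ bp] := mem_circulation aC bc; congr (_ - chi _).
  have [bpar _] := parP b (parent_neq_root hcA bp).
  exact: (parent_unique hcA bp bpar).
rewrite big_map big_seq (eq_bigr _ termE) -big_seq scaler_prod -scalerAr.
rewrite /refined_weight mulrC.
have -> (f : grassmann K n) c : berezin (c *: f) = c * berezin f by rewrite /berezin ffunE.
(* The value 0 at [i] gives the leading factor [chi i] the same shape as the others. *)
congr (_ * _); pose u b : K := if b == i then 0 else -1.
rewrite -(@berezin_triangular K n _ par u d) => [|b]; last first.
  rewrite /u; case: (eqVneq b i) => [_|nbi _]; first by rewrite eqxx.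
  by case: (parP b nbi).
congr berezin.
transitivity (\prod_(b <- codom (cactus_perm C i)) (chi b + u b *: chi (par b))).
  by rewrite /codom /image_mem big_map big_enum_noncomm.
rewrite cactus_perm_codom big_cons {1}/u eqxx scale0r addr0.
congr (_ * _); rewrite big_flatten big_map [LHS]big_seq [RHS]big_seq.
apply: eq_bigr => a aC; rewrite [LHS]big_seq [RHS]big_seq; apply: eq_bigr => b bc.
have [_ _ /(parent_neq_root hcA) nbi] := mem_circulation aC bc.
by rewrite /u (negPf nbi) scaleN1r.
Qed.

End RefinedWeight.

Theorem theorem2 (K : comAlgType rat) (n : nat) (hn : odd n)
    (y : forall k : nat, k.-tuple 'I_n -> K)
    (hy : forall k : nat, odd k -> (3 <= k <= n)%N ->
       completely_antisymmetric (@y k)) :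
  let Z (i : 'I_n) : K :=
    berezin (chi i * gexp (\sum_(3 <= k < n.+1 | odd k)
      (((k.-1)`!%:R^-1 : rat)%:A : K) *:
        \sum_(a : k.-tuple 'I_n) y k a *: \prod_(j <- behead a) chi j)) in
  (forall i j : 'I_n, Z i = Z j) /\
  (forall i : 'I_n,
     Z i = \sum_(cA : {set {set 'I_n}} | `[< odd_cactus cA >])
             cactus_weight y cA).
Proof.
move=> Z.
suff ZE i : Z i = \sum_(cA : {set {set 'I_n}} | `[< odd_cactus cA >]) cactus_weight y cA.
  by split=> [i j|//]; rewrite !ZE.
rewrite /Z (exponentE hy) gexp_expand mulr_sumr.
have -> (s : {set {set 'I_n}} -> grassmann K n) :
    berezin (\sum_cA s cA) = \sum_cA berezin (s cA) by rewrite /berezin sum_ffunE.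
rewrite [RHS]big_mkcond; apply: eq_bigr => cA _ /=.
case: asboolP => [hcA|/(not_cactus_berezin hy) W0]; last exact: W0.
(* One value must serve all [j] and [C]: each refined weight is an integral rooted at [j], and the
   root can be moved to [i]. *)
apply/esym/cactus_weightE => //; first exact: odd_gt0.
by move=> j C rC <-; rewrite (refined_weightE hy j rC); apply: berezin_edge_prod_root.
Qed.
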